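(* For every online algorithm $ALG$, the competitive ratio is at most $0.5$, i.e. the infimum, over all problem instances with $\mathbf{E}[\mathrm{OPT}(I)]>0$, of $\mathbf{E}[\mathrm{ALG}(I)]/\mathbf{E}[\mathrm{OPT}(I)]$ is at most $0.5$.
   Context: Model. Write $[k]=\{1,\dots,k\}$. A problem instance consists of a horizon $[0,T]$; $m$ resources, resource $j\in[m]$ having capacity $c_j>0$; $n$ customer types, where customers of type $i\in[n]$ arrive according to a non-homogeneous Poisson process with known rate $\lambda_i(t)$, $t\in[0,T]$, and finite expected number of arrivals $\Lambda_i=\int_0^T\lambda_i(t)\,dt$ (the processes of different types are independent); and known numbers $u_{ij}\in[0,c_j]$ for $i\in[n],j\in[m]$. When a customer arrives, it must immediately and irrevocably be assigned to one of the resources or rejected. Assigning a type-$i$ customer to resource $j$ consumes exactly $u_{ij}$ units of the capacity of resource $j$ (this is allowed only if at least $u_{ij}$ units of $j$ remain) and earns reward $u_{ij}$. $I$ denotes a sample path of customer arrivals over the whole horizon. An algorithm is online if at any time $t$ it knows only the instance data (including all arrival rates) and the realized arrivals up to time $t$ (it may be randomized); it is offline if it knows $I$ at time $0$. $\mathrm{ALG}(I)$ is the total amount of resources allocated (equivalently total reward) by the algorithm $ALG$ on $I$, and $\mathrm{OPT}(I)$ is that of an optimal offline algorithm. Expectations are over $I$ and the algorithm's randomness. The competitive ratio of an online algorithm is the minimum (infimum) over instances of $\mathbf{E}[\mathrm{ALG}(I)]/\mathbf{E}[\mathrm{OPT}(I)]$. *)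

(* Defs.v *)
From HB Require Import structures.
From mathcomp Require Import all_boot all_order all_algebra.
From mathcomp Require Import all_classical all_reals all_analysis.

Set Implicit Arguments.
Unset Strict Implicit.
Unset Printing Implicit Defensive.

Import Order.TTheory GRing.Theory Num.Theory.

Local Open Scope classical_set_scope.
Local Open Scope ring_scope.

Record instance (R : realType) := Instance {
  horizon : R;
  nres : nat;
  ntypes : nat;
  capacity : 'I_nres -> R;
  rate : 'I_ntypes -> R -> R;
  usage : 'I_ntypes -> 'I_nres -> R;
  horizon_gt0 : 0 < horizon;
  capacity_gt0 : forall j, 0 < capacity j;
  rate_ge0 : forall i t, t \in `[0, horizon] -> 0 <= rate i t;
  (* integrability subsumes measurability and makes the expected number of
     arrivals of each type finite *)
  rate_integrable : forall i,
    lebesgue_measure.-integrable `[0, horizon] (EFin \o rate i);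
  usage_bounds : forall i j, 0 <= usage i j <= capacity j }.

HB.instance Definition _ (T : choiceType) := isPointed.Build (seq T) [::].

Section sample_paths.
Context {R : realType} {n : nat}.

(* An arrival is a pair (time, type). *)
Definition path_cylinders : set (set (seq (R * 'I_n))) :=
  [set A | exists k i (B : set R), measurable B /\
    A = [set s | exists2 t, onth s k = Some (t, i) & B t]].

(* arrivals with time in [0, t], for arrival times that are nonnegative *)
Definition arrivals_upto (i : 'I_n) (s : seq (R * 'I_n)) (t : R) : nat :=
  count (fun a => (a.2 == i) && (a.1 <= t)) s.

(* Simultaneous arrivals are not excluded surely: they have probability 0 under
   Poisson arrivals, and are processed in the order of the sequence. *)
Definition valid_path (T : R) (s : seq (R * 'I_n)) : bool :=
  sorted (fun a b => a.1 <= b.1) s && all (fun a => 0 <= a.1 <= T) s.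

End sample_paths.

(* Finite sequences of arrivals, with the sigma-algebra generated by the time
   and the type of the k-th arrival, for every k (if there is one). *)
Definition sample_path (R : realType) (n : nat) :=
  g_sigma_algebraType (@path_cylinders R n).
HB.instance Definition _ (R : realType) (n : nat) :=
  Measurable.on (sample_path R n).

Section poisson_processes.
Context {d : measure_display} {Omega : measurableType d} {R : realType}.
Variable P : probability Omega R.

(* For families of sigma-algebras, the product rule over the whole index type
   contains the product rule over its subsets: take E k := setT. *)
Definition independent_classes (K : finType) (F : K -> set (set Omega)) :=
  forall E : K -> set Omega, (forall k, F k (E k)) ->
    P (\bigcap_(k in [set: K]) E k) = (\prod_(k : K) P (E k))%E.

Definition sigma_of_var (X : Omega -> nat) : set (set Omega) :=
  preimage_set_system setT X measurable.

Definition sigma_of_process (T : R) (N : R -> Omega -> nat) : set (set Omega) :=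
  <<s \bigcup_(t in `[0, T]) sigma_of_var (N t) >>.

Definition increment (N : R -> Omega -> nat) (s t : R) (w : Omega) : nat :=
  (N t w - N s w)%N.

Definition independent_increments (T : R) (N : R -> Omega -> nat) :=
  forall (K : nat) (t : nat -> R),
    (forall l, 0 <= t l <= T) -> {homo t : a b / (a <= b)%N >-> a <= b} ->
    independent_classes
      (fun l : 'I_K => sigma_of_var (increment N (t l) (t l.+1))).

(* In poisson_prob the second argument is a dummy; mean 0 gives the Dirac mass
   at 0. *)
Definition poisson_process (T : R) (lambda : R -> R) (N : R -> Omega -> nat) :=
  [/\ forall t, 0 <= t <= T -> measurable_fun setT (N t),
      P [set w | N 0 w = 0%N] = 1%E,
      independent_increments T N &
      forall s t, 0 <= s -> s <= t -> t <= T -> forall U : set nat,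
        P (increment N s t @^-1` U) =
        poisson_prob (\int[lebesgue_measure]_(x in `]s, t]) lambda x) 0 U].

End poisson_processes.

Section assignments.
Context {R : realType} (inst : instance R).
Local Notation n := (ntypes inst).
Local Notation m := (nres inst).
Implicit Types (s : seq (R * 'I_n)) (a : seq (option 'I_m)) (j : 'I_m).

(* The k-th item of an assignment a of a sample path s is the resource to which
   the k-th arrival is assigned, or None if that arrival is rejected. *)
Definition consumed s a j : R :=
  \sum_(x <- zip s a | x.2 == Some j) usage x.1.2 j.

(* As usages are nonnegative, this says that every assignment is made while
   enough capacity remains. *)
Definition feasible s a : bool := [forall j, consumed s a j <= capacity j].

Definition reward s a : R :=
  \sum_(x <- zip s a) (if x.2 is Some j then usage x.1.2 j else 0).

(* All-reject is feasible with reward 0, so the base value 0 adds nothing. *)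
Definition opt s : R :=
  \big[Num.max/0]_(a : (size s).-tuple (option 'I_m) | feasible s a) reward s a.

(* The decision for an arrival depends on a random seed, independent of the
   arrivals, and on the arrivals so far, the current one being the last. Past
   decisions are functions of the same data. *)
Definition run {S : Type} (decide : S -> sample_path R n -> option 'I_m)
    (z : S) s : seq (option 'I_m) :=
  [seq decide z (take k.+1 s) | k <- iota 0 (size s)].

Record online_policy := OnlinePolicy {
  seed_disp : measure_display;
  seed : measurableType seed_disp;
  seed_law : probability seed R;
  decide : seed -> sample_path R n -> option 'I_m;
  decide_measurable : forall o,
    measurable [set x : seed * sample_path R n | decide x.1 x.2 = o];
  decide_feasible : forall z s, valid_path (horizon inst) s ->
    feasible s (run decide z s) }.

Record poisson_arrivals := PoissonArrivals {
  arr_disp : measure_display;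
  arr_space : measurableType arr_disp;
  arr_law : probability arr_space R;
  arr_path : arr_space -> sample_path R n;
  arr_path_measurable : measurable_fun setT arr_path;
  arr_path_valid : forall w, valid_path (horizon inst) (arr_path w);
  arr_path_poisson : forall i,
    poisson_process arr_law (horizon inst) (@rate _ inst i)
      (fun t w => arrivals_upto i (arr_path w) t);
  arr_path_independent : independent_classes arr_law
    (fun i => sigma_of_process (horizon inst)
      (fun t w => arrivals_upto i (arr_path w) t)) }.

Definition expected_opt (I : poisson_arrivals) : \bar R :=
  'E_(arr_law I)[fun w => opt (arr_path w)].

Definition expected_alg (alg : online_policy) (I : poisson_arrivals) : \bar R :=
  'E_(arr_law I \x seed_law alg)%E
    [fun x => reward (arr_path x.1) (run (@decide alg) x.2 (arr_path x.1))].

End assignments.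

(* An online algorithm knows the data of the instance, arrival rates included,
   but not the probability space carrying the arrivals. *)
Definition online_algorithm (R : realType) :=
  forall inst : instance R, online_policy inst.

(* The expectations depend on I only through the law of the arrivals, which inst
   determines; ranging over I therefore does not change the infimum. *)
Definition competitive_ratio (R : realType) (ALG : online_algorithm R) : \bar R :=
  ereal_inf [set r : \bar R | exists inst (I : poisson_arrivals inst),
    (0 < expected_opt I)%E /\
    r = (expected_alg (ALG inst) I / expected_opt I)%E].

(* Main.v *)
From HB Require Import structures.
Require Import Defs.
From mathcomp Require Import all_boot all_order all_algebra.
From mathcomp Require Import all_classical all_reals all_analysis.
From mathcomp Require Import measurable_realfun.
From mathcomp Require Import ring lra.

(** Why no online algorithm beats 1/2: one resource of capacity 1 and two
    customer types suffice. Fix a small [e > 0]. Between the times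
    0 and 1 arrive small customers, each using [delta = e ^+ 3], at rate
    [e / delta]; between 1 and 2 arrive big customers, each using the whole
    capacity, at rate [e]. By the
    law of large numbers the small customers amount to [X] close to [e], so that
    they behave like a fluid of known volume [e], while a big customer shows up
    with probability about [e]. Once a single small customer has been accepted,
    no big one fits any more. At the end of the first unit of time an online
    algorithm has therefore committed itself: either it gets at most [X], or it
    gets at most the probability [1 - expR (- e) <= e] of a big arrival. Both
    are about [e]. The offline optimum takes a big customer if there is one and
    the small ones otherwise, which is worth about [2 e].

    The two estimates use only two moments of the Poisson law. For the
    algorithm, [max X e <= e + e ^+ 2 + (X - e) ^+ 2 / (4 e ^+ 2)] and the
    variance of [X] is [delta * e] ([expected_alg_le]); for the optimum, taking
    all small customers when they fit is worth at least [X - X ^+ 2]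
    ([expected_opt_ge]). With [delta = e ^+ 3] the ratio is at most
    [(1 + 2 e) / (2 - 4 e)] ([competitive_ratio_le]).

    The infimum ranges over arrival processes that carry a genuine Poisson law,
    so most of the work is to construct one. A Poisson process on a window is a
    Poisson number of independent uniform points; its sample path lists them in
    increasing order. That the numbers of points in disjoint cells are
    independent Poisson variables is read off the multinomial formula
    [iid_cell_counts], proved by induction on the number of points
    ([poisson_path_disjoint_counts]). The two types live on the two factors of a
    product space, which makes them independent of each other. *)

Set Implicit Arguments.
Unset Strict Implicit.
Unset Printing Implicit Defensive.

Import Order.TTheory GRing.Theory Num.Theory.

Local Open Scope classical_set_scope.
Local Open Scope ring_scope.

(** * Generalities on measures and integer-valued functions *)

Lemma measurable_nat_fun d (T : measurableType d) (f : T -> nat) :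
  (forall k, measurable [set x | f x = k]) -> measurable_fun setT f.
Proof.
move=> mf _ Y _; rewrite setTI (_ : f @^-1` Y = \bigcup_(k in Y) [set x | f x = k]).
  by apply: bigcup_measurable => k _; exact: mf.
apply/seteqP; split => [x Yfx|x [k Yk /= fxk]]; last by rewrite /preimage/= fxk.
by exists (f x).
Qed.

Lemma measure_bigcup_finType {R : realType} d (T : measurableType d)
    (mu : {measure set T -> \bar R}) (L : finType) (F : L -> set T) :
  (forall l, measurable (F l)) -> trivIset setT F ->
  mu (\bigcup_(l in [set: L]) F l) = (\sum_(l : L) mu (F l))%E.
Proof.
move=> mF tF; rewrite measure_fin_bigcup//; last exact: finite_finset.
rewrite (fsbigE (enum L)) ?enum_uniq//; last by move=> l _; rewrite mem_enum.
by rewrite big_enum_cond; apply: eq_bigl => l; rewrite in_setT.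
Qed.

Lemma measure_nat_fibers {R : realType} d (T : measurableType d)
    (mu : {measure set T -> \bar R}) (A : set T) (X : T -> nat) (V : set nat) :
  measurable A -> (forall k, measurable (X @^-1` [set k])) ->
  mu (A `&` X @^-1` V) = (\sum_(k <oo | k \in V) mu (A `&` X @^-1` [set k]))%E.
Proof.
move=> mA mX; rewrite -measure_bigcup.
- congr (mu _); apply/seteqP; split => [w [Aw VXw]|w [k Vk [Aw Xk]]].
    by exists (X w).
  by split => //; rewrite /preimage/= Xk.
- by move=> k _; exact: measurableI.
- apply/trivIsetP => k l _ _ /eqP kl; apply/seteqP.
  by split => // w [[_ /= ->] [_]].
Qed.

Lemma measure_natE {R : realType} (mu : {measure set nat -> \bar R}) (V : set nat) :
  mu V = (\sum_(k <oo | k \in V) mu [set k])%E.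
Proof.
rewrite -{1}[V]setTI (measure_nat_fibers mu _ (X := id))//.
by apply: eq_eseriesr => k _; rewrite setTI.
Qed.

(** Integer-valued variables are independent with prescribed laws as soon as
    their joint probability mass function is the product. The singletons are
    traded for arbitrary sets one coordinate at a time: in one coordinate, both
    sides are countable sums over the points of the set. *)
Lemma joint_law_of_pmf {R : realType} d (T : measurableType d) (L : finType)
    (P : probability T R) (X : L -> T -> nat) (pi : L -> probability nat R) :
  (forall l k, measurable (X l @^-1` [set k])) ->
  (forall k : L -> nat,
    P [set w | forall l, X l w = k l] = (\prod_l pi l [set k l])%E) ->
  forall U : L -> set nat,
    P [set w | forall l, U l (X l w)] = (\prod_l pi l (U l))%E.
Proof.
move=> mX PX; suff H (r : seq L) (U : L -> set nat) :
    (forall l, l \notin r -> exists k, U l = [set k]) ->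
    P [set w | forall l, U l (X l w)] = (\prod_l pi l (U l))%E.
  by move=> U; apply: (H (enum L)) => l; rewrite mem_enum.
(* [r] lists the coordinates whose set may be other than a singleton. *)
elim: r U => [|x r IH] U Ur.
  have /choice[k Uk] : forall l, exists k, U l = [set k] by move=> l; exact: Ur.
  rewrite (_ : mkset _ = [set w | forall l, X l w = k l]) ?PX; last first.
    by apply/seteqP; split => w /= h l; have := h l; rewrite Uk.
  by apply: eq_bigr => l _; rewrite Uk.
pose A := [set w | forall l, l != x -> U l (X l w)].
have mXU l V : measurable (X l @^-1` V).
  rewrite -[X in measurable X]setTI.
  by have := measurable_nat_fun (mX l) measurableT (Y := V); apply.
have mA : measurable A.
  rewrite (_ : A = \bigcap_(l in [set l | l != x]) (X l @^-1` U l)).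
    by apply: fin_bigcap_measurable => //; exact: finite_finset.
  by apply/seteqP; split => w.
rewrite (_ : mkset _ = A `&` X x @^-1` U x); last first.
  apply/seteqP; split => w /=; first by move=> h; split => [l _|]; exact: h.
  by move=> [h hx] l; have [->//|] := eqVneq l x; exact: h.
rewrite measure_nat_fibers// [RHS](bigD1 x)//=.
pose p l : R := fine (pi l (U l)).
rewrite [X in (_ * X)%E](_ : _ = (\prod_(l | l != x) p l)%:E); last first.
  by rewrite -prodEFin; apply: eq_bigr => l _; rewrite fineK// fin_num_measure.
rewrite (measure_natE (pi x)).
rewrite muleC -nneseriesZl//; apply: eq_eseriesr => k _.
pose V l := if l == x then [set k] else U l.
rewrite (_ : A `&` _ = [set w | forall l, V l (X l w)]); last first.
  apply/seteqP; split => w /=.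
    by move=> [h hx] l; rewrite /V; case: eqVneq => [->//|]; exact: h.
  move=> h; split => [l lx|]; first by have := h l; rewrite /V (negbTE lx).
  by have := h x; rewrite /V eqxx.
rewrite IH; last first.
  move=> l lr; rewrite /V; case: eqVneq => [_|lx]; first by exists k.
  by apply: Ur; rewrite inE negb_or lx.
rewrite (bigD1 x)//= muleC /V eqxx; congr (_ * _)%E.
rewrite -prodEFin; apply: eq_bigr => l lx.
by rewrite (negbTE lx) fineK// fin_num_measure.
Qed.

Section product_laws.
Context {R : realType} d1 d2 (T1 : measurableType d1) (T2 : measurableType d2).
Variables (P1 : probability T1 R) (P2 : probability T2 R).

Lemma product_preimage_fst A : measurable A -> (P1 \x P2)%E (fst @^-1` A) = P1 A.
Proof.
move=> mA; rewrite (_ : fst @^-1` A = A `*` setT).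
  by rewrite product_measure1E// [X in (_ * X)%E]probability_setT mule1.
by apply/seteqP; split => [x ?|x []].
Qed.

Lemma product_preimage_snd A : measurable A -> (P1 \x P2)%E (snd @^-1` A) = P2 A.
Proof.
move=> mA; rewrite (_ : snd @^-1` A = setT `*` A).
  by rewrite product_measure1E// [X in (X * _)%E]probability_setT mul1e.
by apply/seteqP; split => [x ?|x []].
Qed.

End product_laws.

(** * Integrals of nonnegative functions *)

Section integral_bounds.
Import HBNNSimple.
Context {R : realType}.
Local Open Scope ereal_scope.

(** The integral of a nonnegative function is the supremum of the integrals of
    the simple functions below it, hence a lower integral, monotone on all
    nonnegative functions. *)
Lemma ge0_le_integral_lower d (T : measurableType d)
    (mu : {measure set T -> \bar R}) (f g : T -> \bar R) :
  (forall x, 0 <= f x) -> (forall x, f x <= g x) ->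
  \int[mu]_x f x <= \int[mu]_x g x.
Proof.
move=> f0 fg; rewrite !ge0_integralTE//; last first.
  by move=> x; exact: le_trans (f0 x) (fg x).
apply: le_ereal_sup => _ [h hf <-]; exists h => // x; exact: le_trans (hf x) (fg x).
Qed.

(** One half of Tonelli's theorem holds for arbitrary nonnegative functions: it
    is enough to apply the theorem to the simple functions below [f]. The
    integrand will be the reward of a policy, [T1] and [T2] carrying the
    arrivals of the two types and [T3] the seed of the policy; slicing over
    [T2] expresses that the policy decides on the first type before it sees the
    second. *)
Lemma integral_le_slices d1 d2 d3 (T1 : measurableType d1) (T2 : measurableType d2)
    (T3 : measurableType d3) (P1 : probability T1 R) (P2 : probability T2 R)
    (P3 : probability T3 R) (f : (T1 * T2) * T3 -> \bar R) (g : T1 -> \bar R) :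
  (forall x, 0 <= f x) ->
  (forall x z, \int[P2]_y f ((x, y), z) <= g x) ->
  \int[(P1 \x P2) \x P3]_w f w <= \int[P1]_x g x.
Proof.
move=> f0 fg; rewrite [leLHS]ge0_integralTE//.
apply: ge_ereal_sup => _ [h hf <-].
rewrite -integralT_nnsfun.
have mh : measurable_fun setT (fun w => (h w)%:E) by exact/measurable_EFinP.
have h0 w : 0 <= (h w)%:E by rewrite lee_fin.
pose P12 : probability (T1 * T2)%type R := P1 \x P2.
rewrite [leLHS](fubini_tonelli2 (m1 := P12) (m2 := P3) (fun w => (h w)%:E) mh h0).
rewrite -[leRHS]mule1 -(probability_setT P3) -integral_cst//.
apply: ge0_le_integral_lower => z; first exact: integral_ge0.
have mhz : measurable_fun setT (fun w => (h (w, z))%:E).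
  exact: (measurable_fun_pair1 z mh).
rewrite [leLHS](fubini_tonelli1 (m1 := P1) (m2 := P2) _ mhz (fun w => h0 (w, z))).
apply: ge0_le_integral_lower => x; first exact: integral_ge0.
rewrite /fubini_F; apply: le_trans (fg x z).
by apply: ge0_le_integral_lower => // y; exact: hf.
Qed.

End integral_bounds.

(** * Measurability on the space of sample paths *)

Section path_measurability.
Context {R : realType} {n : nat}.
Local Notation point := (R * 'I_n)%type.
Local Notation spath := (sample_path R n).
Implicit Types (A : pred point) (s : spath).

Definition measurable_pred (A : pred point) :=
  forall i, measurable [set t | A (t, i)].

Lemma measurable_onth (k : nat) A : measurable_pred A ->
  measurable [set s : spath | exists2 x, onth s k = Some x & A x].
Proof.
move=> mA; rewrite (_ : mkset _ = \bigcup_(i in [set: 'I_n])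
  [set s : spath | exists2 t, onth s k = Some (t, i) & [set t | A (t, i)] t]).
  apply: fin_bigcup_measurable => // i _.
  by apply: sub_sigma_algebra; exists k, i, [set t | A (t, i)]; split.
apply/seteqP; split => [s [[t i] sk Ati]|s [i _ [t sk Ati]]].
  by exists i => //; exists t.
by exists (t, i).
Qed.

Lemma measurable_size_gt (k : nat) : measurable [set s : spath | (k < size s)%N].
Proof.
rewrite (_ : mkset _ =
    [set s : spath | exists2 x, onth s k = Some x & (fun=> true) x]).
  by apply: measurable_onth => i; rewrite set_true.
apply/seteqP; split => s /=; rewrite -onthTE.
  by case: (onth s k) => // y _; exists y.
by move=> [x -> _].
Qed.

Lemma measurable_size (k : nat) : measurable [set s : spath | size s = k].
Proof.
case: k => [|k].
  rewrite (_ : mkset _ = ~` [set s | (0 < size s)%N]).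
    by apply: measurableC; exact: measurable_size_gt.
  by apply/seteqP; split => s /=; [move=> ->|case: (size s) => // m []].
rewrite (_ : mkset _ = [set s | (k < size s)%N] `\` [set s | (k.+1 < size s)%N]).
  by apply: measurableD; exact: measurable_size_gt.
apply/seteqP; split => s /=; first by move=> ->; rewrite ltnSn ltnn.
by move=> [ks /negP]; rewrite -leqNgt => sk; apply/eqP; rewrite eqn_leq sk.
Qed.

Lemma count_onth A (s : spath) m : (size s <= m)%N ->
  count A s = (\sum_(k < m) (if onth s k is Some x then A x : bool else false))%N.
Proof.
elim: s m => [|x s IH] m /=; first by rewrite big1// => k _; rewrite onth0n.
by case: m => // m /IH ->; rewrite big_ord_recl.
Qed.

(** The count is the sum over all positions of the indicator of [A] at that
    position; on paths of a given size this sum is finite. *)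
Lemma measurable_count A : measurable_pred A ->
  measurable_fun setT (count A : spath -> nat).
Proof.
move=> mA; apply: measurable_nat_fun => k.
(* [c m] counts among the first [m] arrivals only. *)
pose c m (s : spath) :=
  (\sum_(j < m) (if onth s j is Some x then A x : bool else false))%N.
have mc m : measurable_fun setT (c m).
  elim: m => [|m IH].
    rewrite (_ : c 0%N = cst 0%N); first exact: measurable_cst.
    by apply/funext => s; rewrite /c big_ord0.
  apply: measurable_nat_fun => j.
  pose B := [set s : spath | exists2 x, onth s m = Some x & A x].
  have mB : measurable B by exact: measurable_onth.
  have mcj l : measurable [set s | c m s = l].
    by rewrite -[X in measurable X]setTI; exact: (IH measurableT [set l]).
  rewrite (_ : mkset _ = (B `&` [set s | (c m s).+1 = j]) `|`
                         (~` B `&` [set s | c m s = j])).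
    apply: measurableU; apply: measurableI => //.
    - case: j => [|j].
        by rewrite (_ : [set s | (c m s).+1 = 0%N] = set0) //; apply/seteqP; split.
      rewrite (_ : [set s | (c m s).+1 = j.+1] = [set s | c m s = j]) //.
      by apply/seteqP; split => [s [] //|s /= ->].
    - exact: measurableC.
  apply/seteqP; split => s; rewrite /B /= /c big_ord_recr /=.
    case E : (onth s m) => [x|] /=.
      case Ax : (A x) => /=.
        by rewrite addn1 => <-; left; split => //; exists x.
      by rewrite addn0 => <-; right; split => // -[y [<-]]; rewrite Ax.
    by rewrite addn0 => <-; right; split => // -[].
  case=> [[[x -> ->]]|[]]; first by rewrite addn1.
  case: (onth s m) => [x|] nA; last by rewrite addn0.
  by case Ax : (A x); [exfalso; apply: nA; exists x|rewrite addn0].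
rewrite (_ : mkset _ = \bigcup_m ([set s | size s = m] `&` [set s | c m s = k])).
  apply: bigcup_measurable => m _; apply: measurableI; first exact: measurable_size.
  by rewrite -[X in measurable X]setTI; exact: (mc m measurableT [set k]).
apply/seteqP; split => [s <-|s [m _ [/= sm <-]]].
  by exists (size s) => //; split => //=; rewrite /c -count_onth.
by rewrite /c -count_onth ?sm.
Qed.

Lemma measurable_count_set A (U : set nat) : measurable_pred A ->
  measurable [set s : spath | U (count A s)].
Proof.
move=> mA; rewrite -[X in measurable X]setTI.
by have := measurable_count mA measurableT (Y := U); apply.
Qed.

End path_measurability.

(** * Independent points and their multinomial law *)

Section iid_points.
Context {R : realType} {n : nat} (i : 'I_n).
Variable nu : probability (measurableTypeR R) R.
Local Notation spath := (sample_path R n).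

Definition add_point (x : measurableTypeR R * spath) : spath := (x.1, i) :: x.2.

Lemma measurable_add_point : measurable_fun setT add_point.
Proof.
have gen := (@measurability _ _ (measurableTypeR R * spath)%type spath setT
  add_point (@path_cylinders R n) erefl).
apply: gen => _ [_ [k [j [B [mB ->]]]] <-].
rewrite setTI; case: k => [|k].
  have [ij|ij] := eqVneq i j.
    rewrite (_ : _ @^-1` _ = B `*` setT); first exact: measurableX.
    apply/seteqP; split => [[t s] /= [u [<- _]]//|[t s] [/= Bt _]].
    by exists t; rewrite // ij.
  rewrite (_ : _ @^-1` _ = set0)//; apply/seteqP; split => [[t s] /= [u [_ ji]]|//].
  by rewrite ji eqxx in ij.
rewrite (_ : _ @^-1` _ =
  setT `*` [set s : spath | exists2 t, onth s k = Some (t, j) & B t]).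
  apply: measurableX => //; apply: sub_sigma_algebra.
  by exists k, j, B.
by apply/seteqP; split => [[t s] /= ?|[t s] [_ /=]].
Qed.

HB.instance Definition _ :=
  isMeasurableFun.Build _ _ _ _ add_point measurable_add_point.

(** The law of [m] independent arrivals of type [i] with times of law [nu], in
    no particular order: each step draws one more time, independently. *)
Fixpoint iid_law (m : nat) : probability spath R :=
  if m is m'.+1 then distribution (nu \x iid_law m')%E add_point
  else \d_([::] : spath).

Lemma iid_lawS m A : iid_law m.+1 A = (nu \x iid_law m)%E (add_point @^-1` A).
Proof. by []. Qed.

Section counts.
Variables (L : finType) (c : R * 'I_n -> L).
Hypothesis mc : forall l, measurable_pred (fun x => c x == l).
Implicit Types (k : L -> nat) (q : L -> R) (s : spath).

Definition cell_count s l := count (fun x => c x == l) s.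

Definition cell_prob l : R := fine (nu [set t | c (t, i) == l]).

Lemma cell_probE l : nu [set t | c (t, i) == l] = (cell_prob l)%:E.
Proof. by rewrite /cell_prob fineK// fin_num_measure//; exact: mc. Qed.

Lemma sum_cell_prob : \sum_l cell_prob l = 1.
Proof.
apply: EFin_inj; rewrite -sumEFin -(probability_setT nu).
under eq_bigr do rewrite -cell_probE.
rewrite -(measure_bigcup_finType nu (F := fun l => [set t | c (t, i) == l])).
- by congr (nu _); apply/seteqP; split => // t _; exists (c (t, i)) => /=.
- by move=> l; exact: mc.
- apply/trivIsetP => l l' _ _ ll'; apply/seteqP.
  by split => // t [/= /eqP -> /eqP]; apply/eqP.
Qed.

(** The multinomial probability of the cell counts [k] divided by the
    factorial of the total number of points: without that factor the induction
    step becomes the linear recursion [multinom_weight_decr]. *)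
Definition multinom_weight q k : R := \prod_l (q l ^+ k l / (k l)`!%:R).

Definition decr l k := fun l' => (k l' - (l' == l))%N.

Lemma multinom_weight_decr q k l : (0 < k l)%N ->
  q l * multinom_weight q (decr l k) = (k l)%:R * multinom_weight q k.
Proof.
move=> kl0; rewrite /multinom_weight (bigD1 l)//= [in RHS](bigD1 l)//= !mulrA.
congr (_ * _); last first.
  by apply: eq_bigr => l' ll'; rewrite /decr (negbTE ll') subn0.
rewrite /decr eqxx subn1; case: (k l) kl0 => // m _ /=.
rewrite factS natrM exprS invfM; field.
by rewrite pnatr_eq0 -lt0n fact_gt0 nat1r pnatr_eq0.
Qed.

Lemma measurable_cell_counts k :
  measurable [set s : spath | forall l, cell_count s l = k l].
Proof.
rewrite (_ : mkset _ = \bigcap_(l in [set: L]) [set s | cell_count s l = k l]).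
  apply: fin_bigcap_measurable => [|l _]; first exact: finite_finset.
  exact: (measurable_count_set [set k l] (mc l)).
by apply/seteqP; split => [s h l _|s h l]; [exact: (h l)|exact: (h l Logic.I)].
Qed.

Lemma sum_decr l k : (0 < k l)%N -> (\sum_l' k l' = (\sum_l' decr l k l').+1)%N.
Proof.
move=> kl; rewrite (bigD1 l)//= [in RHS](bigD1 l)//=.
rewrite /decr eqxx subn1 -addSn prednK//.
by congr addn; apply: eq_bigr => l' /negbTE ->; rewrite subn0.
Qed.

(** The multinomial law. Conditioning on the cell [l] of the first point, the
    other [m] points have to realize [decr l k]; summing [(k l)%:R] over [l]
    turns [m`!] into [m.+1`!]. *)
Lemma iid_cell_counts m k :
  iid_law m [set s | forall l, cell_count s l = k l] =
  (if m == (\sum_l k l)%N then m`!%:R * multinom_weight cell_prob k else 0)%:E.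
Proof.
elim: m k => [|m IH] k.
  rewrite /= diracE; have [k0|k0] := eqVneq.
    have kl l : k l = 0%N.
      by move/esym/eqP : k0; rewrite sum_nat_eq0 => /forallP/(_ l)/eqP.
    rewrite mem_set => [|l /=]; last by rewrite kl.
    rewrite fact0 mul1r /multinom_weight big1// => l _.
    by rewrite kl expr0 fact0 divr1.
  rewrite memNset// => /= h; case/negP: k0; rewrite eq_sym sum_nat_eq0.
  by apply/forallP => l; rewrite -h.
(* The remaining points when the first one falls in cell [l]. *)
pose E l := [set s | forall l', (((l == l') + cell_count s l')%N = k l')].
have EE l : E l = if (0 < k l)%N
    then [set s | forall l', cell_count s l' = decr l k l'] else set0.
  case: ifPn => [kl|]; last first.
    rewrite -leqNgt leqn0 => /eqP kl.
    by apply/seteqP; split => // s /(_ l); rewrite eqxx kl.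
  apply/seteqP; split => s /= h l'; first by rewrite /decr -h eq_sym addnC addnK.
  rewrite h /decr; case: eqVneq => [<-|]; first by rewrite subn1 add1n prednK.
  by rewrite subn0.
have mE l : measurable (E l).
  by rewrite EE; case: ifP => // _; exact: measurable_cell_counts.
rewrite iid_lawS (_ : _ @^-1` _ =
    \bigcup_(l in [set: L]) ([set t | c (t, i) == l] `*` E l)); last first.
  apply/seteqP; split => [[t s] /= h|[t s] [l _ [/= /eqP <- h]] l']; last exact: h.
  by exists (c (t, i)) => //; split => //= l'; exact: h.
rewrite measure_bigcup_finType; last 2 first.
- by move=> l; apply: measurableX => //; exact: mc.
- apply/trivIsetP => l l' _ _ ll'; apply/seteqP.
  by split => // -[t s] [[/= /eqP -> _] [/= /eqP]]; move/eqP; rewrite (negbTE ll').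
rewrite [LHS](eq_bigr (fun l => (if m.+1 == (\sum_l k l)%N
   then (k l)%:R * (m`!%:R * multinom_weight cell_prob k) else 0)%:E)); last first.
  move=> l _; transitivity (nu [set t | c (t, i) == l] * iid_law m (E l))%E.
    by apply: product_measure1E => //; exact: mc.
  rewrite cell_probE EE; case: ifPn => [kl|]; last first.
    rewrite -leqNgt leqn0 => /eqP ->.
    by rewrite measure0 mule0 mul0r if_same.
  rewrite IH (sum_decr kl) eqSS -EFinM; case: ifP => _; last by rewrite mulr0.
  by rewrite mulrCA multinom_weight_decr// mulrCA.
rewrite sumEFin; congr EFin; case: ifPn => [/eqP mk|_]; last by rewrite big1.
by rewrite -mulr_suml -natr_sum -mk factS natrM mulrA.
Qed.

End counts.
End iid_points.

(** * The Poisson law and its moments *)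

Section poisson_pmf.
Context {R : realType}.
Implicit Types (mu : R) (k : nat).

(** Unlike [poisson_pmf], whose value is [1] throughout for mean 0, these
    weights are those of [poisson_prob] for mean 0 as well. *)
Definition pois mu k : R := mu ^+ k / k`!%:R * expR (- mu).

Lemma pois_ge0 mu k : 0 <= mu -> 0 <= pois mu k.
Proof. by move=> mu0; rewrite mulr_ge0// ?expR_ge0// divr_ge0// exprn_ge0. Qed.

Lemma poisson_prob1 mu k : 0 <= mu -> poisson_prob mu 0 [set k] = (pois mu k)%:E.
Proof.
rewrite le_eqVlt /poisson_prob /poisson_pmf => /predU1P[<-|mu0].
  rewrite ltxx diracE; case: k => [|k].
    by rewrite mem_set// /pois expr0 fact0 oppr0 expR0 divr1 mulr1.
  by rewrite memNset// /pois expr0n mul0r mul0r.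
by rewrite mu0 esum_set1// lee_fin pois_ge0// ltW.
Qed.

Lemma pois_sum1 mu : 0 <= mu -> (\sum_(k <oo) (pois mu k)%:E = 1)%E.
Proof.
move=> mu0; rewrite -(probability_setT (poisson_prob mu 0)).
rewrite (measure_natE (poisson_prob mu 0)).
rewrite [RHS](eq_eseriesl (Q := xpredT)); last by move=> k; rewrite in_setT.
by apply: eq_eseriesr => k _; exact/esym/poisson_prob1.
Qed.

End poisson_pmf.

Section poisson_moments.
Context {R : realType}.
Implicit Types (m : R) (g : nat -> R).
Local Open Scope ereal_scope.

Definition pois_sum m g : \bar R := \sum_(k <oo) (g k * pois m k)%:E.

Lemma pois_sumD m g1 g2 :
  (0 <= m)%R -> (forall k, 0 <= g1 k)%R -> (forall k, 0 <= g2 k)%R ->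
  pois_sum m (fun k => g1 k + g2 k)%R = pois_sum m g1 + pois_sum m g2.
Proof.
move=> m0 g10 g20; rewrite /pois_sum -nneseriesD//.
- by apply: eq_eseriesr => k _; rewrite mulrDl.
- by move=> k _ _; rewrite lee_fin mulr_ge0// pois_ge0.
- by move=> k _ _; rewrite lee_fin mulr_ge0// pois_ge0.
Qed.

Lemma pois_sumZ m c g : (0 <= m)%R -> (forall k, 0 <= g k)%R ->
  pois_sum m (fun k => c * g k)%R = c%:E * pois_sum m g.
Proof.
move=> m0 g0; rewrite /pois_sum -nneseriesZl//; last first.
  by move=> k _; rewrite lee_fin mulr_ge0// pois_ge0.
by apply: eq_eseriesr => k _; rewrite -mulrA EFinM.
Qed.

Lemma pois_sum_cst m c : (0 <= m)%R -> (0 <= c)%R -> pois_sum m (fun=> c) = c%:E.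
Proof.
move=> m0 c0; transitivity (pois_sum m (fun=> (c * 1)%R)).
  by apply: eq_eseriesr => k _; rewrite mulr1.
rewrite pois_sumZ// -[RHS]mule1 -(pois_sum1 m0); congr (_ * _).
by apply: eq_eseriesr => k _; rewrite mul1r.
Qed.

(** The identity [k * pois m k = m * pois m (k - 1)], which gives all moments. *)
Lemma pois_sum_shift m g : (0 <= m)%R -> (forall k, 0 <= g k)%R ->
  pois_sum m (fun k => k%:R * g k)%R = m%:E * pois_sum m (fun k => g k.+1).
Proof.
move=> m0 g0; rewrite /pois_sum nneseries_recl//; last first.
  by move=> k _; rewrite lee_fin; apply: mulr_ge0; [exact: mulr_ge0|exact: pois_ge0].
rewrite !mul0r add0e -nneseriesZl//; last first.
  by move=> k _; rewrite lee_fin mulr_ge0// pois_ge0.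
rewrite -(nneseries_addn (f := fun k => (k%:R * g k * pois m k)%:E) 1); last first.
  by move=> k; rewrite lee_fin; apply: mulr_ge0; [exact: mulr_ge0|exact: pois_ge0].
apply: eq_eseriesr => k _; rewrite addn1 -EFinM; congr EFin.
rewrite /pois factS natrM exprS; field.
by rewrite pnatr_eq0 -lt0n fact_gt0 nat1r pnatr_eq0.
Qed.

Lemma pois_sum_id m : (0 <= m)%R -> pois_sum m (fun k => k%:R)%R = m%:E.
Proof.
move=> m0; transitivity (pois_sum m (fun k => k%:R * 1)%R).
  by apply: eq_eseriesr => k _; rewrite mulr1.
by rewrite pois_sum_shift// pois_sum_cst// mule1.
Qed.

Lemma pois_sum_sqr m : (0 <= m)%R ->
  pois_sum m (fun k => k%:R ^+ 2)%R = (m ^+ 2 + m)%:E.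
Proof.
move=> m0; transitivity (pois_sum m (fun k => k%:R * k%:R)%R) => //.
rewrite pois_sum_shift//.
transitivity (m%:E * pois_sum m (fun k => k%:R + 1)%R).
  by congr (_ * _); apply: eq_eseriesr => k _; rewrite natr1.
by rewrite pois_sumD// pois_sum_cst// pois_sum_id// -EFinD -EFinM mulrDr mulr1.
Qed.

Lemma pois_variance m : (0 <= m)%R ->
  pois_sum m (fun k => (k%:R - m) ^+ 2)%R = m%:E.
Proof.
move=> m0.
(* The cross term is moved to the other side, to add nonnegative series only. *)
have : pois_sum m (fun k => (k%:R - m) ^+ 2 + (2 * m) * k%:R)%R =
       pois_sum m (fun k => k%:R ^+ 2 + m ^+ 2)%R.
  by apply: eq_eseriesr => k _; congr (_ * _)%:E; ring.
rewrite !pois_sumD//; last 3 first.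
- by move=> _; exact: sqr_ge0.
- by move=> k; exact: sqr_ge0.
- by move=> k; rewrite !mulr_ge0.
rewrite pois_sumZ// pois_sum_id// pois_sum_sqr// pois_sum_cst ?sqr_ge0//.
rewrite -EFinM -EFinD; case: (pois_sum _ _) => [r|//|//] [e].
by congr EFin; apply: (addIr (2 * m * m)%R); rewrite e; ring.
Qed.

Lemma le_pois_sum m g1 g2 : (0 <= m)%R -> (forall k, 0 <= g1 k <= g2 k)%R ->
  pois_sum m g1 <= pois_sum m g2.
Proof.
move=> m0 g12; apply: lee_nneseries => [k _|k _].
  by rewrite lee_fin mulr_ge0// ?pois_ge0//; case/andP: (g12 k).
by rewrite lee_fin ler_wpM2r ?pois_ge0//; case/andP: (g12 k).
Qed.

Lemma integral_pois d (T : measurableType d) (P : probability T R)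
    (N : T -> nat) m g :
  (0 <= m)%R -> (forall k, 0 <= g k)%R ->
  (forall k, measurable [set w | N w = k]) ->
  (forall k, P [set w | N w = k] = (pois m k)%:E) ->
  \int[P]_w (g (N w))%:E = pois_sum m g.
Proof.
move=> m0 g0 mN PN.
have TN : setT = \bigcup_k [set w | N w = k].
  by apply/seteqP; split => // w _; exists (N w).
rewrite TN ge0_integral_bigcup//.
- apply: eq_eseriesr => k _.
  rewrite (eq_integral (fun=> (g k)%:E)); last by move=> w /set_mem/= ->.
  by rewrite integral_cst// EFinM; congr (_ * _); exact: PN.
- rewrite -TN; apply: (measurableT_comp (f := fun k => (g k)%:E)) => //.
  exact: measurable_nat_fun.
- by move=> w _; rewrite lee_fin.
- by apply/trivIsetP => k l _ _ /eqP kl; apply/seteqP; split => // w [/= ->].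
Qed.

End poisson_moments.

(** * Poisson point processes *)

Section poisson_path_law.
Context {R : realType} {n : nat} (i : 'I_n).
Variables (nu : probability (measurableTypeR R) R) (mu : {nonneg R}).
Local Notation spath := (sample_path R n).

Definition pois_nng k : {nonneg R} := NngNum (pois_ge0 k (ge0 mu)).

(** A Poisson number of independent points: the mixture of the laws [iid_law]
    with Poisson weights. *)
Definition poisson_path_law : set spath -> \bar R :=
  mseries (fun m => mscale (pois_nng m) (iid_law i nu m)) 0.

HB.instance Definition _ := Measure.on poisson_path_law.

Lemma poisson_path_lawE A : poisson_path_law A =
  (\sum_(m <oo) (pois mu%:num m)%:E * iid_law i nu m A)%E.
Proof. by []. Qed.

Let poisson_path_law_setT : poisson_path_law setT = 1%E.
Proof.
rewrite poisson_path_lawE -(pois_sum1 (ge0 mu)); apply: eq_eseriesr => m _.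
by rewrite probability_setT mule1.
Qed.

HB.instance Definition _ :=
  Measure_isProbability.Build _ _ _ poisson_path_law poisson_path_law_setT.

Section counts.
Variables (L : finType) (c : R * 'I_n -> L).
Hypothesis mc : forall l, measurable_pred (fun x => c x == l).

(** The cells partition all points, so that the counts determine the number of
    points: a single term of the mixture contributes, and its factorial
    cancels with the one in the Poisson weight. *)
Lemma poisson_path_cell_counts (k : L -> nat) :
  poisson_path_law [set s | forall l, cell_count c s l = k l] =
  (\prod_l poisson_prob (mu%:num * cell_prob i nu c l) 0 [set k l])%E.
Proof.
have q0 l : 0 <= cell_prob i nu c l by exact: fine_ge0.
pose K := (\sum_l k l)%N.
rewrite poisson_path_lawE (nneseriesD1 (n := K))//; last first.
  by move=> m _; rewrite mule_ge0// lee_fin pois_ge0.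
rewrite [X in (_ + X)%E]eseries0 ?adde0; last first.
  by move=> m _ mK; rewrite iid_cell_counts// (negbTE mK) mule0.
rewrite iid_cell_counts// eqxx -EFinM.
under [RHS]eq_bigr do rewrite poisson_prob1 ?mulr_ge0//.
rewrite prodEFin; congr EFin.
rewrite /pois big_split/= -expR_sum sumrN -mulr_sumr sum_cell_prob// mulr1.
transitivity (mu%:num ^+ K * multinom_weight (cell_prob i nu c) k *
              expR (- mu%:num)).
  by field; rewrite pnatr_eq0 -lt0n fact_gt0.
congr (_ * _); rewrite /multinom_weight -prodrXr -big_split/=.
apply: eq_bigr => l _.
by rewrite exprMn mulrA.
Qed.

End counts.
End poisson_path_law.

Section disjoint_counts.
Context {R : realType} {n : nat} (i : 'I_n).
Variables (nu : probability (measurableTypeR R) R) (mu : {nonneg R}).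
Local Notation spath := (sample_path R n).
Implicit Types A : pred (R * 'I_n).

Definition mean_count A : R := mu%:num * fine (nu [set t | A (t, i)]).

(** Disjoint sets of points become a partition into cells, indexed by
    [option K], when [None] is the cell of all remaining points; no condition
    is put on the count of that cell. *)
Lemma poisson_path_disjoint_counts (K : finType) (B : K -> pred (R * 'I_n)) :
  (forall l, measurable_pred (B l)) ->
  (forall x l l', B l x -> B l' x -> l = l') ->
  forall U : K -> set nat,
    poisson_path_law i nu mu [set s | forall l, U l (count (B l) s)] =
    (\prod_l poisson_prob (mean_count (B l)) 0 (U l))%E.
Proof.
move=> mB Bl U; pose c (x : R * 'I_n) : option K := [pick l | B l x].
have cS x l : (c x == Some l) = B l x.
  rewrite /c; case: pickP => [l' Bl'x|nB]; last by rewrite nB.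
  by apply/eqP/idP => [[<-]//|Blx]; congr Some; exact: Bl Blx.
have mc o : measurable_pred (fun x => c x == o).
  case: o => [l|] j.
    rewrite (_ : [set t | c (t, j) == Some l] = [set t | B l (t, j)]).
      exact: mB.
    by apply/seteqP; split => t /=; rewrite cS.
  rewrite (_ : [set t | c (t, j) == None] =
      ~` \bigcup_(l in [set: K]) [set t | B l (t, j)]).
    apply: measurableC; apply: fin_bigcup_measurable => [|l _]; last exact: mB.
    exact: finite_finset.
  apply/seteqP; split => t /=; rewrite /c; case: pickP => //.
    by move=> nB _ [l _ /=]; rewrite nB.
  by move=> l Bltj []; exists l.
pose V o := if o is Some l then U l else setT.
have mcc o k : measurable ((fun s : spath => cell_count c s o) @^-1` [set k]).
  exact: (measurable_count_set [set k] (mc o)).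
have := joint_law_of_pmf (P := poisson_path_law i nu mu)
  (pi := fun l => poisson_prob (mu%:num * cell_prob i nu c l) 0)
  mcc (poisson_path_cell_counts i nu mu mc) V.
rewrite (bigD1 None)//= probability_setT mul1e => VE.
rewrite (_ : mkset _ =
    [set s : spath | forall l, V l (cell_count c s l)]); last first.
  apply/seteqP; split => s /= h; last first.
    by move=> l; have := h (Some l); rewrite /cell_count (eq_count (a2 := B l)).
  by move=> [l|//]; rewrite /V /cell_count (eq_count (a2 := B l)).
rewrite [LHS]VE (reindex_omap Some id)/=; last by case.
apply: eq_big => [l|l _]; first by rewrite eqxx.
congr (poisson_prob _ _ _); rewrite /mean_count /cell_prob.
by congr (_ * fine (nu _)); apply/funext => t /=; rewrite cS.
Qed.

Lemma poisson_path_count A (U : set nat) : measurable_pred A ->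
  poisson_path_law i nu mu [set s | U (count A s)] =
  poisson_prob (mean_count A) 0 U.
Proof.
move=> mA.
have := @poisson_path_disjoint_counts unit (fun=> A) (fun=> mA) _ (fun=> U).
rewrite big_const card_unit /= mule1 => <-; last by move=> x [] [].
by congr (poisson_path_law _ _ _ _); apply/seteqP; split => s //= /(_ tt).
Qed.

End disjoint_counts.

(** * Poisson processes on a time window *)

Section window_process.
Context {R : realType} {n : nat} (i : 'I_n).
Variables (a b : R) (ab : a < b) (mu : {nonneg R}).
Local Notation spath := (sample_path R n).
Local Notation leb := (@lebesgue_measure R).

Definition in_window (x : R * 'I_n) := (x.2 == i) && (a <= x.1 <= b).

(** Arbitrary lists serve as outcomes; points of another type or outside of
    the window, which have probability 0, are discarded. *)
Definition window_count (t : R) (s : spath) : nat :=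
  count (fun x => in_window x && (x.1 <= t)) s.

Definition window_law : probability spath R :=
  poisson_path_law i (uniform_prob ab) mu.

Definition window_rate (t : R) : R := mu%:num * uniform_pdf a b t.

Lemma measurable_window (B : set R) : measurable B ->
  measurable_pred (fun x => in_window x && (x.1 \in B)).
Proof.
move=> mB j; have [->|ji] := eqVneq j i; last first.
  rewrite (_ : [set t | _] = set0)//; apply/seteqP; split => // t /=.
  by rewrite /in_window /= (negbTE ji).
rewrite (_ : [set t | _] = `[a, b] `&` B); first exact: measurableI.
apply/seteqP; split => t; rewrite /in_window /= eqxx /= in_itv /=.
  by move=> /andP[-> /set_mem].
by move=> [-> Bt]; rewrite mem_set.
Qed.

Lemma mean_count_window (B : set R) : measurable B ->
  mean_count i (uniform_prob ab) mu (fun x => in_window x && (x.1 \in B)) =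
  \int[leb]_(t in B) window_rate t.
Proof.
move=> mB; rewrite RintegralZl//; last first.
  exact: integrableS (integrable_uniform_pdf ab).
rewrite /mean_count; congr (_ * fine _).
rewrite /uniform_prob integral_uniform_pdf [RHS]integral_uniform_pdf.
congr (integral _ _ _); apply/seteqP.
split => t; rewrite /in_window /= eqxx /= in_itv /=.
  by move=> /andP[abt /set_mem Bt].
by move=> [[Bt abt] _]; rewrite abt mem_set.
Qed.

Context d (Omega : measurableType d) (P : probability Omega R) (S : Omega -> spath).
Hypothesis mS : measurable_fun setT S.
Hypothesis PS : forall A, measurable A -> P (S @^-1` A) = window_law A.

Local Notation process := (fun t w => window_count t (S w)).

Lemma window_increment s t w : s <= t -> increment process s t w =
  count (fun x => in_window x && (x.1 \in `]s, t]%classic)) (S w).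
Proof.
move=> st; rewrite /increment /window_count.
pose A1 x := in_window x && (x.1 <= s).
pose A2 x := in_window x && (x.1 \in `]s, t]%classic).
rewrite -/A1 -/A2; set c := count _ _.
suff -> : c = (count A1 (S w) + count A2 (S w))%N by rewrite addKn.
rewrite -count_predUI [X in (_ + X)%N](_ : _ = 0)%N ?addn0; last first.
  apply/eqP; rewrite -leqn0 -(count_pred0 (S w)); apply: sub_count => x /=.
  by rewrite /A1 /A2 mem_setE in_itv/=; case: (leP x.1 s); rewrite ?andbF//= andbF.
apply: eq_count => x; rewrite /A1 /A2 /= mem_setE in_itv/= -andb_orr; congr andb.
by case: (leP x.1 s) => //= xs; rewrite (le_trans xs).
Qed.

Lemma measurable_law_count A (U : set nat) : measurable_pred A ->
  measurable [set w | U (count A (S w))].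
Proof.
move=> mA; rewrite -[X in measurable X]setTI.
exact: (mS measurableT (measurable_count_set U mA)).
Qed.

Lemma window_law_count (B : set R) (U : set nat) : measurable B ->
  P [set w | U (count (fun x => in_window x && (x.1 \in B)) (S w))] =
  poisson_prob (\int[leb]_(t in B) window_rate t) 0 U.
Proof.
move=> mB; rewrite -mean_count_window// -poisson_path_count//; last first.
  exact: measurable_window.
by rewrite -PS//; apply: measurable_count_set; exact: measurable_window.
Qed.

(** The increments of the counting process over consecutive intervals are the
    counts of points in disjoint sets. *)
Lemma window_poisson_process (T : R) : 0 <= a ->
  poisson_process P T window_rate process.
Proof.
move=> a0; split.
- move=> t _; apply: measurable_nat_fun => k.
  apply: (measurable_law_count [set k]).
  have := @measurable_window `]-oo, t]%classic (measurable_itv _).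
  by under eq_fun do rewrite mem_setE in_itv/=.
(* Only time 0 of the window can count, a null set. *)
- have := @window_law_count `]-oo, 0]%classic [set 0%N] (measurable_itv _).
  rewrite (_ : \int[leb]_(t in _) _ = 0); last first.
    rewrite RintegralZl//; last exact: integrableS (integrable_uniform_pdf ab).
    rewrite /Rintegral integral_uniform_pdf.
    have [a_gt0|a_le0] := ltP 0 a.
      rewrite (_ : _ `&` _ = set0) ?integral_set0 ?mulr0//.
      apply/seteqP; split => // t [/=]; rewrite !in_itv/= => t0 /andP[at_ _].
      by have := lt_le_trans a_gt0 (le_trans at_ t0); rewrite ltxx.
    have a00 : a = 0 by apply/eqP; rewrite eq_le a_le0.
    rewrite (_ : _ `&` _ = [set 0]) ?integral_set1 ?mulr0//.
    apply/seteqP; split => t /=; rewrite !in_itv/= a00.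
      by move=> [t0 /andP[t0' _]]; apply/eqP; rewrite eq_le t0.
    by move=> ->; rewrite !lexx -a00 ltW.
  rewrite (_ : poisson_prob 0 0 [set 0%N] = 1%E); last first.
    by rewrite /poisson_prob ltxx diracE mem_set.
  move=> <-.
  congr (P _); apply/funext => w /=; congr (_ = _); apply: eq_count => x.
  by rewrite mem_setE in_itv.
- move=> K t tT t_mono E mE.
  have /choice[U EU] : forall l : 'I_K, exists U : set nat,
      E l = [set w | U (increment process (t l) (t l.+1) w)].
    by move=> l; have [U _ <-] := mE l; exists U; rewrite setTI.
  pose B (l : 'I_K) := `]t l, t l.+1]%classic.
  have mB l : measurable (B l) by exact: measurable_itv.
  have EB l : E l =
      [set w | U l (count (fun x => in_window x && (x.1 \in B l)) (S w))].
    by rewrite EU; apply/funext => w /=; rewrite window_increment// t_mono.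
  rewrite (_ : \bigcap_(l in _) E l = S @^-1` [set s | forall l,
      U l (count (fun x => in_window x && (x.1 \in B l)) s)]); last first.
    apply/seteqP; split => [w h l|w h l _].
      by have := h l Logic.I; rewrite EB.
    by rewrite EB; exact: h.
  rewrite PS; last first.
    rewrite (_ : mkset _ = \bigcap_(l in [set: 'I_K]) [set s : spath |
        U l (count (fun x => in_window x && (x.1 \in B l)) s)]).
      apply: fin_bigcap_measurable => [|l _]; first exact: finite_finset.
      by apply: (measurable_count_set (U l) (measurable_window (mB l))).
    by apply/seteqP; split => [w h l _|w h l]; [exact: (h l)|exact: (h l Logic.I)].
  rewrite [LHS](@poisson_path_disjoint_counts _ _ i (uniform_prob ab) mu 'I_K
    (fun l x => in_window x && (x.1 \in B l))).
  + apply: eq_bigr => l _.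
    by rewrite EB (window_law_count _ (mB l)) (mean_count_window (mB l)).
  + by move=> l; exact: measurable_window (mB l).
  + move=> x l l' /andP[_ +] /andP[_]; rewrite !mem_setE !in_itv/=.
    move=> /andP[lx xl] /andP[lx' xl'].
    apply: val_inj => /=; case: (ltngtP l l') => // ll'.
      by have := lt_le_trans lx' (le_trans xl (t_mono _ _ ll')); rewrite ltxx.
    by have := lt_le_trans lx (le_trans xl' (t_mono _ _ ll')); rewrite ltxx.
- move=> s t s0 st tT U; rewrite -window_law_count//.
  by congr (P _); apply/funext => w /=; rewrite window_increment.
Qed.

End window_process.

Lemma measurable_window_count {R : realType} {n : nat} (i : 'I_n) (a b t : R) :
  measurable_fun setT (window_count i a b t : sample_path R n -> nat).
Proof.
apply: measurable_count; have := measurable_window i a b (measurable_itv `]-oo, t]).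
by under eq_fun do rewrite mem_setE in_itv/=.
Qed.

(** * Sorting and concatenating sample paths *)

Section sorted_paths.
Context {R : realType} {n : nat}.
Local Notation point := (R * 'I_n)%type.
Local Notation spath := (sample_path R n).

Definition time_le (x y : point) := x.1 <= y.1.

Lemma time_le_total : total time_le. Proof. by move=> x y; exact: le_total. Qed.

Lemma time_le_trans : transitive time_le.
Proof. by move=> y x z; exact: le_trans. Qed.

Definition sorted_part (A : pred point) (s : spath) : spath :=
  sort time_le (seq.filter A s).

Lemma sorted_sorted_part A s : sorted time_le (sorted_part A s).
Proof. exact: sort_sorted time_le_total _. Qed.

Lemma count_sorted_part A B s : count B (sorted_part A s) = count (predI B A) s.
Proof. by rewrite (permP (permEl (perm_sort _ _))) count_filter. Qed.

Lemma all_sorted_part A s : all A (sorted_part A s).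
Proof. by rewrite all_sort filter_all. Qed.

(** In a sorted sequence, the items that satisfy a downward closed predicate
    form an initial segment. *)
Lemma sorted_nth_count (T : Type) (x0 : T) (r : rel T) (p : pred T) (s : seq T) k :
  transitive r -> (forall x y, r x y -> p y -> p x) -> sorted r s ->
  (k < size s)%N -> p (nth x0 s k) = (k < count p s)%N.
Proof.
move=> r_trans rp; elim: s k => //= x s IH k xs.
have [px|npx] /= := boolP (p x).
  by case: k => //= k ks; rewrite IH// (path_sorted xs).
have : all (predC p) s.
  apply: sub_all (order_path_min r_trans xs) => y rxy.
  by apply: contra npx; exact: rp.
rewrite all_predC has_count -leqNgt leqn0 => /eqP c0.
rewrite c0 addn0 ltn0; case: k => [|k] ks /=; first exact/negbTE.
by rewrite IH ?c0// (path_sorted xs).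
Qed.

Variables (i : 'I_n) (A : pred point).
Hypotheses (mA : measurable_pred A) (Ai : forall x, A x -> x.2 = i).

Lemma size_sorted_part s : size (sorted_part A s) = count A s.
Proof. by rewrite size_sort size_filter. Qed.

(** The [k]-th earliest arrival time is less than [x] exactly when more than [k]
    arrivals occur before [x], and counts are measurable. *)
Lemma measurable_order_statistic k :
  measurable_fun [set s : spath | (k < count A s)%N]
    (fun s => (nth (0, i) (sorted_part A s) k).1).
Proof.
apply: (@measurability _ _ spath R _ _ _ (RGenInftyO.measurableE R)).
move=> _ [_ [x ->] <-].
rewrite (_ : _ `&` _ =
    [set s : spath | (k < count (predI (fun y => y.1 < x)%R A) s)%N]).
  apply: (measurable_count_set [set m | (k < m)%N]) => j.
  rewrite (_ : [set t | _] = `]-oo, x[ `&` [set t | A (t, j)]); last first.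
    by apply/seteqP; split => t /=; rewrite in_itv/= => /andP.
  by apply: measurableI => //; exact: mA.
have nthE s : (k < count A s)%N -> ((nth (0, i) (sorted_part A s) k).1 < x) =
    (k < count (predI (fun y => y.1 < x)%R A) s)%N.
  move=> ks; rewrite -count_sorted_part.
  rewrite -(sorted_nth_count (0, i) time_le_trans _ (sorted_sorted_part A s))//.
  - by move=> y z; exact: le_lt_trans.
  - by rewrite size_sorted_part.
apply/seteqP; split => s /=; first by move=> [ks]; rewrite in_itv/= nthE.
move=> ks; have kA : (k < count A s)%N.
  by apply: leq_trans ks _; apply: sub_count => y /andP[].
by split => //; rewrite in_itv/= nthE.
Qed.

Lemma measurable_sorted_part : measurable_fun setT (sorted_part A).
Proof.
apply: (@measurability _ _ spath spath _ _ (@path_cylinders R n) erefl).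
move=> _ [_ [k [j [B [mB ->]]]] <-]; rewrite setTI.
have [ij|ij] := eqVneq i j; last first.
  rewrite (_ : _ @^-1` _ = set0)//; apply/seteqP; split => // s /= [t st _].
  have := all_sorted_part A s => /(all_nthP (0, i))/(_ k).
  have -> := onth_nth (0, i) _ _ _ st; rewrite -onthTE st => /(_ isT) /Ai /= ji.
  by rewrite ji eqxx in ij.
rewrite (_ : _ @^-1` _ = [set s | (k < count A s)%N] `&`
    (fun s => (nth (0, i) (sorted_part A s) k).1) @^-1` B).
  have mk := measurable_count_set [set m | (k < m)%N] mA.
  exact: (measurable_order_statistic mk mB).
apply/seteqP; split => s /=; rewrite -size_sorted_part -onthTE.
  by move=> [t st Bt]; rewrite st; have -> := onth_nth (0, i) _ _ _ st.
move=> [sk Bk]; case E : (onth _ k) sk => [[t j']|]// _.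
have nE := onth_nth (0, i) _ _ _ E; exists t; last by rewrite nE in Bk.
have := all_sorted_part A s => /(all_nthP (0, i))/(_ k).
by rewrite nE -onthTE E => /(_ isT) /Ai /= ->; rewrite ij.
Qed.

End sorted_paths.

Lemma measurable_cat {R : realType} {n : nat} d (T : measurableType d)
    (f g : T -> sample_path R n) :
  measurable_fun setT f -> measurable_fun setT g ->
  measurable_fun setT (fun x => f x ++ g x : sample_path R n).
Proof.
move=> mf mg.
apply: (@measurability _ _ T (sample_path R n) _ _ (@path_cylinders R n) erefl).
move=> _ [_ [k [j [B [mB ->]]]] <-]; rewrite setTI.
pose E m := [set s : sample_path R n | exists2 t, onth s m = Some (t, j) & B t].
have mE m : measurable (E m) by apply: sub_sigma_algebra; exists m, j, B.
have mfE A : measurable A -> measurable (f @^-1` A).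
  by move=> mA; rewrite -[X in measurable X]setTI; exact: mf.
have mgE A : measurable A -> measurable (g @^-1` A).
  by move=> mA; rewrite -[X in measurable X]setTI; exact: mg.
rewrite (_ : _ @^-1` _ = (f @^-1` [set s | (k < size s)%N] `&` f @^-1` E k) `|`
   \bigcup_(m in [set m | (m <= k)%N])
     (f @^-1` [set s | size s = m] `&` g @^-1` E (k - m)%N)).
  apply: measurableU.
    by apply: measurableI; apply: mfE => //; exact: measurable_size_gt.
  apply: bigcup_measurable => m _; apply: measurableI; last exact: mgE.
  by apply: mfE; exact: measurable_size.
apply/seteqP; split => x; rewrite /E /= onth_cat.
  case: ltnP => kf; first by left.
  by move=> ?; right; exists (size (f x)).
move=> [[-> //]|[m /= mk [fm]]]; by rewrite fm ltnNge mk.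
Qed.

(** * The hard instance and its arrivals *)

Lemma sigma_of_process_comp {R : realType} d (Omega : measurableType d) d'
    (T' : measurableType d') (T : R) (f : Omega -> T') (N : R -> T' -> nat) :
  (forall t, measurable_fun setT (N t)) ->
  sigma_of_process T (fun t w => N t (f w)) `<=`
  preimage_set_system setT f measurable.
Proof.
move=> mN; apply: smallest_sub.
  exact/sigma_algebra_preimage/sigma_algebra_measurable.
move=> _ [t _] [V _ <-]; exists (N t @^-1` V); last by rewrite setTI.
by rewrite -[X in measurable X]setTI; exact: mN.
Qed.

Lemma ord2_cases (i : 'I_2) : i = 0 \/ i = 1.
Proof. by case: i => -[|[|//]] i2; [left|right]; exact: val_inj. Qed.

Section hard_instance.
Context {R : realType} (mu eps : {nonneg R}) (delta : R).
Hypothesis delta01 : 0 <= delta <= 1.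

(** Type 0 is that of the small customers, type 1 that of the big ones. *)
Definition window_start (i : 'I_2) : R := i%:R.
Definition window_end (i : 'I_2) : R := i.+1%:R.
Definition mean_arrivals (i : 'I_2) : {nonneg R} := if i == 0 then mu else eps.
Definition size_of (i : 'I_2) : R := if i == 0 then delta else 1.

Lemma window_lt i : window_start i < window_end i.
Proof. by rewrite ltr_nat. Qed.

Definition type_rate (i : 'I_2) : R -> R :=
  window_rate (window_start i) (window_end i) (mean_arrivals i).

Lemma type_rate_ge0 i (t : R) : t \in `[0, 2] -> 0 <= type_rate i t.
Proof. by move=> _; rewrite mulr_ge0// uniform_pdf_ge0// window_lt. Qed.

Lemma type_rate_integrable i :
  lebesgue_measure.-integrable `[0, 2] (EFin \o type_rate i).
Proof.
have := integrableZl measurableT (mean_arrivals i)%:num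
  (integrable_uniform_pdf (window_lt i)).
exact: integrableS.
Qed.

Lemma size_bounds (i : 'I_2) (j : 'I_1) : 0 <= size_of i <= 1.
Proof. by rewrite /size_of; case: ifP => // _; rewrite ler01 lexx. Qed.

Definition hard_instance : instance R :=
  @Instance R 2 1 2 (fun=> 1) type_rate (fun i _ => size_of i)
    (ltr0Sn R 1) (fun=> ltr01) type_rate_ge0 type_rate_integrable size_bounds.

Local Notation spath := (sample_path R 2).
Local Notation win i := (@in_window R 2 i (window_start i) (window_end i)).

Definition coord (i : 'I_2) (x : spath * spath) : spath :=
  if i == 0 then x.1 else x.2.

Lemma measurable_coord i : measurable_fun setT (coord i).
Proof.
by rewrite /coord; case: (i == 0); [exact: measurable_fst|exact: measurable_snd].
Qed.

Definition type_law (i : 'I_2) : probability spath R :=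
  window_law i (window_lt i) (mean_arrivals i).

Definition type_part (i : 'I_2) (s : spath) : spath := sorted_part (win i) s.

(** All small customers arrive before the big ones: the two windows meet at time
    1 only. *)
Definition merged_path (x : spath * spath) : spath :=
  type_part 0 x.1 ++ type_part 1 x.2.

Lemma win_type i x : win i x -> x.2 = i.
Proof. by move=> /andP[/eqP]. Qed.

Lemma type_part_type (i : 'I_2) (s : spath) :
  all (fun x => x.2 == i) (type_part i s).
Proof.
by apply: sub_all (all_sorted_part _ s) => x /win_type /eqP.
Qed.

Lemma measurable_win i : measurable_pred (win i).
Proof.
have := @measurable_window R 2 i (window_start i) (window_end i) setT measurableT.
by under eq_fun do rewrite in_setT andbT.
Qed.

Lemma measurable_type_part i : measurable_fun setT (type_part i).
Proof. exact: measurable_sorted_part (measurable_win i) (@win_type i). Qed.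

Lemma measurable_merged_path : measurable_fun setT merged_path.
Proof.
apply: measurable_cat.
  exact: measurableT_comp (measurable_type_part 0) measurable_fst.
exact: measurableT_comp (measurable_type_part 1) measurable_snd.
Qed.

Lemma valid_merged_path x : valid_path 2 (merged_path x).
Proof.
have part_win i (s : spath) : all (win i) (type_part i s) by exact: all_sorted_part.
apply/andP; split.
  rewrite /merged_path (sorted_pairwise (@time_le_trans R 2)) pairwise_cat.
  rewrite -!(sorted_pairwise (@time_le_trans R 2)) !sorted_sorted_part !andbT.
  apply/allrelP => y z /(allP (part_win _ _))/andP[_ /andP[_ y1]].
  move=> /(allP (part_win _ _))/andP[_ /andP[z1 _]].
  exact: le_trans y1 z1.
rewrite all_cat; apply/andP; split.
  apply: sub_all (part_win 0 x.1) => y /andP[_ /andP[y0 y1]].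
  by rewrite y0/= (le_trans y1)// ler_nat.
apply: sub_all (part_win 1 x.2) => y /andP[_ /andP[y0 y1]].
by rewrite y1 andbT (le_trans _ y0).
Qed.

Lemma arrivals_merged_path i x t : arrivals_upto i (merged_path x) t =
  window_count i (window_start i) (window_end i) t (coord i x).
Proof.
rewrite /arrivals_upto /coord count_cat !count_sorted_part.
have part j s : count (predI (fun a => (a.2 == i) && (a.1 <= t)) (win j)) s =
    if i == j then window_count i (window_start i) (window_end i) t s else 0%N.
  case: eqVneq => [<-|ij].
    apply: eq_count => y /=; rewrite /in_window; case: (y.2 == i) => //=.
    by rewrite andbC.
  apply/eqP; rewrite -leqn0 leqNgt -has_count; apply/hasP => -[y _ /=].
  move=> /andP[/andP[/eqP yi _] /win_type yj].
  by rewrite -yi yj eqxx in ij.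
rewrite !part; case: i part => -[|[|//]] i2 _ /=; by rewrite ?addn0 ?add0n.
Qed.

Definition hard_law : probability (spath * spath)%type R :=
  (type_law 0%R \x type_law 1%R)%E.

Lemma coord_law i A : measurable A -> hard_law (coord i @^-1` A) = type_law i A.
Proof.
move=> mA; have [->|->] := ord2_cases i.
  exact: (product_preimage_fst (type_law 0) (type_law 1) mA).
exact: (product_preimage_snd (type_law 0) (type_law 1) mA).
Qed.

Lemma merged_poisson i : poisson_process hard_law 2 (type_rate i)
  (fun t w => arrivals_upto i (merged_path w) t).
Proof.
under eq_fun do under eq_fun do rewrite arrivals_merged_path.
apply: window_poisson_process (measurable_coord i) (coord_law i) _ _.
by rewrite ler0n.
Qed.

(** The process of each type depends on one factor of the product space. *)
Lemma merged_independent : independent_classes hard_law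
  (fun i => sigma_of_process 2 (fun t w => arrivals_upto i (merged_path w) t)).
Proof.
move=> E mE.
have EA i : exists2 A, measurable A & E i = coord i @^-1` A.
  have := mE i.
  under eq_fun do under eq_fun do rewrite arrivals_merged_path.
  move=> /(sigma_of_process_comp (f := coord i)
    (measurable_window_count i (window_start i) (window_end i))) [A mA <-].
  by exists A => //; rewrite setTI.
have [A mA EA0] := EA 0; have [B mB EB1] := EA 1.
rewrite big_ord_recl big_ord1 (_ : lift _ _ = 1); last exact: val_inj.
rewrite (_ : \bigcap_(k in _) E k = A `*` B).
  by rewrite [LHS]product_measure1E// EA0 EB1 !coord_law.
apply/seteqP; split => x.
  by move=> h; have := h 0 Logic.I; have := h 1 Logic.I; rewrite EA0 EB1.
by move=> [Ax Bx] i _; have [->|->] := ord2_cases i; rewrite ?EA0 ?EB1.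
Qed.

Definition hard_arrivals : poisson_arrivals hard_instance :=
  @PoissonArrivals R hard_instance _ _ hard_law merged_path
    measurable_merged_path valid_merged_path merged_poisson merged_independent.

End hard_instance.

(** * Rewards along a sample path *)

Section pathwise.
Context {R : realType} (mu eps : {nonneg R}) (delta : R).
Hypothesis delta01 : 0 <= delta <= 1.
Local Notation inst := (hard_instance mu eps delta01).
Local Notation point := (R * 'I_2)%type.
Implicit Types (s : seq point) (a : seq (option 'I_1)).

Definition accepted a : R := (count isSome a)%:R.

(** With a single resource, the reward is the amount of it that is consumed. *)
Lemma consumed_reward s a j :
  consumed (inst := inst) s a j = reward (inst := inst) s a.
Proof.
rewrite /consumed /reward big_mkcond; apply: eq_bigr => -[x [j'|]] _ //=.
by rewrite (ord1 j') (ord1 j) eqxx.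
Qed.

Lemma feasibleE s a :
  feasible (inst := inst) s a = (reward (inst := inst) s a <= 1).
Proof.
apply/forallP/idP => [/(_ 0)|h j]; first by rewrite consumed_reward.
by rewrite consumed_reward.
Qed.

Lemma reward_cat s1 s2 a1 a2 : size s1 = size a1 ->
  reward (inst := inst) (s1 ++ s2) (a1 ++ a2) =
  reward (inst := inst) s1 a1 + reward (inst := inst) s2 a2.
Proof. by move=> sz; rewrite /reward zip_cat// big_cat. Qed.

Lemma reward_const (i : 'I_2) s a : size s = size a -> all (fun x => x.2 == i) s ->
  reward (inst := inst) s a = size_of delta i * accepted a.
Proof.
rewrite /reward /accepted; elim: s a => [|x s IH] [|o a]//=.
  by rewrite big_nil mulr0.
move=> [sz] /andP[/eqP xi si]; rewrite big_cons IH// natrD mulrDr; congr (_ + _).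
by case: o => [j|]/=; rewrite ?mulr1 ?mulr0// xi.
Qed.

Lemma reward_hard s1 s2 a1 a2 : size s1 = size a1 -> size s2 = size a2 ->
  all (fun x => x.2 == 0) s1 -> all (fun x => x.2 == 1) s2 ->
  reward (inst := inst) (s1 ++ s2) (a1 ++ a2) = delta * accepted a1 + accepted a2.
Proof.
move=> sz1 sz2 t1 t2.
rewrite reward_cat// (reward_const sz1 t1) (reward_const sz2 t2).
by rewrite /size_of /= mul1r.
Qed.

Lemma reward_ge0 s a : 0 <= reward (inst := inst) s a.
Proof.
apply: sumr_ge0 => -[x [j|]] _ //=.
by have /andP[] := size_bounds delta01 x.2 j.
Qed.

Lemma opt_ge s1 s2 a1 a2 : size s1 = size a1 -> size s2 = size a2 ->
  all (fun x => x.2 == 0) s1 -> all (fun x => x.2 == 1) s2 ->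
  delta * accepted a1 + accepted a2 <= 1 ->
  delta * accepted a1 + accepted a2 <= opt (inst := inst) (s1 ++ s2).
Proof.
move=> sz1 sz2 t1 t2 le1; have rE := reward_hard sz1 sz2 t1 t2.
have sz : size (a1 ++ a2) == size (s1 ++ s2) by rewrite !size_cat sz1 sz2.
rewrite -rE /opt.
apply: (le_bigmax_cond 0 (j := Tuple sz)
  (fun a : (size (s1 ++ s2)).-tuple _ => reward (inst := inst) (s1 ++ s2) a)).
by rewrite feasibleE /= rE.
Qed.

Lemma opt_ge0 s : 0 <= opt (inst := inst) s.
Proof. exact: bigmax_ge_id. Qed.

(** The offline choice: the first big customer if there is one; otherwise all
    small ones if they fit. If they do not, then [1 < X] and [X - X ^+ 2 < 0]. *)
Lemma opt_hard_ge s1 s2 (X := delta * (size s1)%:R) :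
  all (fun x => x.2 == 0) s1 -> all (fun x => x.2 == 1) s2 ->
  (if (0 < size s2)%N then 1 else Num.max 0 (X - X ^+ 2)) <=
  opt (inst := inst) (s1 ++ s2).
Proof.
move=> t1 t2; case: ifPn => [|_].
  case: s2 t2 => // x s2 t2 _.
  have := @opt_ge s1 (x :: s2) (nseq (size s1) None)
    (Some 0 :: nseq (size s2) None).
  rewrite /= !size_nseq /accepted/= !count_nseq /= !mul0n mulr0 add0r addn0; exact.
rewrite ge_max opt_ge0 /=; have [X1|X1] := leP X 1; last first.
  apply: le_trans (opt_ge0 _).
  by rewrite subr_le0 expr2 ler_peMl// ltW// (lt_trans ltr01).
apply: (@le_trans _ _ X); first by rewrite gerBl sqr_ge0.
have := @opt_ge s1 s2 (nseq (size s1) (Some 0)) (nseq (size s2) None).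
by rewrite !size_nseq /accepted !count_nseq /= mul0n mul1n addr0; exact.
Qed.

(** Being online: the decisions on the arrivals [s1] do not depend on the
    arrivals [s2] that follow. *)
Lemma run_cat (S : Type) (decide : S -> sample_path R 2 -> option 'I_1) z s1 s2 :
  exists a2, [/\ size s2 = size a2,
    size s1 = size (run (inst := inst) decide z s1) &
    run (inst := inst) decide z (s1 ++ s2) =
    run (inst := inst) decide z s1 ++ a2].
Proof.
rewrite /run size_cat iotaD map_cat.
eexists; split; last first.
- congr (_ ++ _); apply/eq_in_map => k; rewrite mem_iota add0n => /andP[_ ks].
  by rewrite takel_cat.
- by rewrite size_map size_iota.
- by rewrite size_map size_iota.
Qed.

Lemma accepted_eq0 a : ~~ has isSome a -> accepted a = 0.
Proof. by rewrite has_count -leqNgt leqn0 /accepted => /eqP ->. Qed.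

Lemma accepted_le a : accepted a <= (size a)%:R.
Proof. by rewrite ler_nat count_size. Qed.

(** A small customer, once accepted, leaves room for less than a big one. The
    alternative is decided by the small arrivals and the seed alone. *)
Lemma alg_hard_le (delta_gt0 : 0 < delta) (S : Type)
    (decide : S -> sample_path R 2 -> option 'I_1) z s1 s2 :
  all (fun x => x.2 == 0) s1 -> all (fun x => x.2 == 1) s2 ->
  feasible (inst := inst) (s1 ++ s2) (run (inst := inst) decide z (s1 ++ s2)) ->
  reward (inst := inst) (s1 ++ s2) (run (inst := inst) decide z (s1 ++ s2)) <=
  if has isSome (run (inst := inst) decide z s1) then delta * (size s1)%:R
  else (0 < size s2)%:R.
Proof.
move=> t1 t2; have [a2 [sz2 sz1 ->]] := run_cat decide z s1 s2.
rewrite feasibleE reward_hard//; set a1 := run _ _ _ in sz1 *.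
case: ifPn => [a1S|/accepted_eq0 ->]; last first.
  rewrite mulr0 add0r => a21; case: ltnP => // s2_0.
  by apply: le_trans (accepted_le _) _; rewrite -sz2 ler_nat.
move=> le1; have a20 : accepted a2 = 0.
  have a1_1 : 1 <= accepted a1 by rewrite ler1n -has_count.
  have : accepted a2 < 1.
    apply: lt_le_trans le1; rewrite ltrDr mulr_gt0//; exact: lt_le_trans a1_1.
  by rewrite ltrn1 ltnS leqn0 /accepted => /eqP ->.
rewrite a20 addr0 ler_pM2l//; apply: le_trans (accepted_le _) _.
by rewrite -sz1.
Qed.

End pathwise.

(** * Expected rewards on the hard instance *)

Section hard_expectations.
Context {R : realType} (mu eps : {nonneg R}) (delta : R).
Hypothesis delta01 : 0 <= delta <= 1.
Local Notation inst := (hard_instance mu eps delta01).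
Local Notation arrivals := (hard_arrivals mu eps delta01).
Local Notation law := (@type_law R mu eps).
Local Notation mean := (@mean_arrivals R mu eps).
Local Notation spath := (sample_path R 2).

Definition part_size (i : 'I_2) (s : spath) : nat := size (type_part i s).

Lemma measurable_part_size i (U : set nat) : measurable [set s | U (part_size i s)].
Proof.
rewrite /part_size /type_part; under eq_set do rewrite size_sorted_part.
exact: measurable_count_set (measurable_win i).
Qed.

Lemma part_size_law i k :
  law i [set s | part_size i s = k] = (pois (mean i)%:num k)%:E.
Proof.
rewrite /part_size /type_part; under eq_set do rewrite size_sorted_part.
rewrite [LHS](poisson_path_count _ _ _ [set k] (measurable_win i)).
rewrite /mean_count (_ : fine _ = 1) ?mulr1; first exact: poisson_prob1.
rewrite (_ : [set t | _] = `[window_start i, window_end i]%classic).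
  by rewrite [X in fine X](integral_uniform_pdf1 (window_lt i) (@subset_refl _ _)).
by apply/seteqP; split => t; rewrite /in_window /= eqxx in_itv.
Qed.

Lemma integral_part_size i (g : nat -> R) : (forall k, 0 <= g k) ->
  (\int[law i]_s (g (part_size i s))%:E = pois_sum (mean i)%:num g)%E.
Proof.
move=> g0; apply: integral_pois => // k.
  exact: (measurable_part_size i [set k]).
exact: part_size_law.
Qed.

Lemma part_pos_law i :
  law i [set s | (0 < part_size i s)%N] = (1 - expR (- (mean i)%:num))%:E.
Proof.
rewrite (_ : mkset _ = ~` [set s | part_size i s = 0%N]); last first.
  by apply/seteqP; split => s /=; [move=> + s0; rewrite s0|rewrite lt0n => /eqP].
rewrite [LHS]probability_setC; last exact: (measurable_part_size i [set 0%N]).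
rewrite EFinB; congr (_ - _)%E; rewrite [LHS]part_size_law.
by rewrite /pois expr0 fact0 divr1 mul1r.
Qed.

Hypotheses (delta_gt0 : 0 < delta) (eps_gt0 : 0 < eps%:num).
Hypothesis mean_amount : delta * mu%:num = eps%:num.

Let e := eps%:num.

(** A quadratic upper bound of [max X e] in the amount [X = delta * k%:R] of
    small customers, by [y <= e ^+ 2 + y ^+ 2 / (4 e ^+ 2)] at [y = X - e]. *)
Definition alg_bound (k : nat) : R :=
  e + e ^+ 2 + (delta * k%:R - e) ^+ 2 / (4 * e ^+ 2).

Lemma alg_bound_ge_eps k : e <= alg_bound k.
Proof.
rewrite /alg_bound -addrA lerDl addr_ge0 ?sqr_ge0// divr_ge0 ?sqr_ge0//.
by rewrite mulr_ge0// sqr_ge0.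
Qed.

Lemma alg_bound_ge_amount k : delta * k%:R <= alg_bound k.
Proof.
rewrite /alg_bound; set X := delta * k%:R.
have e2 : 0 < e ^+ 2 by rewrite exprn_gt0.
rewrite -subr_ge0 (_ : _ - X = (X - e - 2 * e ^+ 2) ^+ 2 / (4 * e ^+ 2)).
  by rewrite divr_ge0 ?sqr_ge0// mulr_ge0// ltW.
by field; rewrite gt_eqF.
Qed.

Lemma pois_sum_alg_bound :
  pois_sum mu%:num alg_bound = (e + e ^+ 2 + delta / (4 * e))%:E.
Proof.
have e2 : 0 < e ^+ 2 by rewrite exprn_gt0.
have m0 : 0 <= mu%:num by [].
pose c := delta ^+ 2 / (4 * e ^+ 2).
have c0 : 0 <= c by rewrite divr_ge0 ?sqr_ge0// mulr_ge0// ltW.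
transitivity (pois_sum mu%:num (fun k => (e + e ^+ 2) + c * (k%:R - mu%:num) ^+ 2)).
  apply: eq_eseriesr => k _; congr (_ * _)%:E; rewrite /alg_bound /c.
  have -> : delta * k%:R - e = delta * (k%:R - mu%:num).
    by rewrite mulrBr mean_amount.
  by rewrite exprMn mulrAC.
have ee0 : 0 <= e + e ^+ 2 by rewrite addr_ge0// ltW.
rewrite pois_sumD//; last by move=> k; rewrite mulr_ge0// sqr_ge0.
rewrite pois_sumZ//; last by move=> k; exact: sqr_ge0.
rewrite pois_variance// pois_sum_cst// -EFinM -EFinD; congr (_ + _)%:E.
have e_neq0 : e != 0 by rewrite gt_eqF.
rewrite (_ : c * mu%:num = delta * (delta * mu%:num) / (4 * e ^+ 2)); last first.
  by rewrite /c; field.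
by rewrite mean_amount -/e; field.
Qed.

(** For given small arrivals and a given seed the algorithm has either taken a
    small customer, and gets at most their amount, or it gets at most the
    probability [1 - expR (- e) <= e] of a big arrival. *)
Lemma expected_alg_le (alg : online_policy inst) :
  (expected_alg alg arrivals <= (e + e ^+ 2 + delta / (4 * e))%:E)%E.
Proof.
have G0 k : 0 <= alg_bound k by apply: le_trans (alg_bound_ge_eps k); exact: ltW.
rewrite /expected_alg unlock.
apply: le_trans (@integral_le_slices R _ _ _ _ _ _ (law 0) (law 1) (seed_law alg) _
  (fun s => (alg_bound (part_size 0 s))%:E) _ _) _.
- by move=> w; rewrite lee_fin reward_ge0.
- move=> x z.
  pose b := has isSome (run (inst := inst) (@decide _ _ alg) z (type_part 0 x)).
  pose h y : \bar R := (if b then delta * (part_size 0 x)%:R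
      else (0 < part_size 1%R y)%N%:R)%:E.
  apply: (le_trans (ge0_le_integral_lower (law 1) (g := h) _ _)).
  - by move=> y; rewrite lee_fin reward_ge0.
  - move=> y; rewrite lee_fin; apply: alg_hard_le => //; try exact: type_part_type.
    exact: (@decide_feasible R inst alg z _ (valid_merged_path (x, y))).
  rewrite /h; case: b {h}.
    rewrite [leLHS](integral_cst (law 1) (@measurableT _ spath)).
    by rewrite [X in (_ * X)%E]probability_setT mule1 lee_fin alg_bound_ge_amount.
  rewrite (_ : (fun y => _) =
      (fun y => (\1_[set s | (0 < part_size 1%R s)%N] y)%:E)); last first.
    by apply/funext => y; rewrite indicE mem_setE.
  rewrite [leLHS](integral_indic (law 1) (@measurableT _ spath)
    (measurable_part_size 1 [set k | (0 < k)%N])) setIT.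
  rewrite [leLHS]part_pos_law lee_fin; apply: le_trans (alg_bound_ge_eps _).
  by rewrite lerBlDr -lerBlDl; apply: le_trans (expR_ge1Dx _); rewrite addrC.
by rewrite [leLHS]integral_part_size// pois_sum_alg_bound.
Qed.

(** The lower bound of [opt_hard_ge] for [k] small and [l] big arrivals. *)
Definition opt_bound (k l : nat) : R :=
  if (0 < l)%N then 1 else Num.max 0 (delta * k%:R - (delta * k%:R) ^+ 2).

Lemma opt_bound_ge0 k l : 0 <= opt_bound k l.
Proof. by rewrite /opt_bound; case: ifP => // _; rewrite le_max lexx. Qed.

Lemma pois_sum_opt_bound m k : 0 <= m ->
  pois_sum m (opt_bound k) =
  (opt_bound k 0 * expR (- m) + (1 - expR (- m)))%:E.
Proof.
move=> m0; have q0 : pois m 0 = expR (- m) by rewrite /pois expr0 fact0 divr1 mul1r.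
have := pois_sum1 m0; rewrite (nneseriesD1 (n := 0%N))//; last first.
  by move=> l _; rewrite lee_fin pois_ge0.
rewrite q0 => S1; rewrite /pois_sum (nneseriesD1 (n := 0%N))//; last first.
  by move=> l _; rewrite lee_fin mulr_ge0 ?opt_bound_ge0 ?pois_ge0.
rewrite q0.
rewrite (_ : (\sum_(0 <= l <oo | true && (l != 0%N)) _ =
    \sum_(0 <= l <oo | true && (l != 0%N)) (pois m l)%:E)%E); last first.
  by apply: eq_eseriesr => -[|l]// _; rewrite /opt_bound /= mul1r.
move: S1; case: (\big[_/_]_(_ <= _ <oo | _) _)%E => [r|//|//] [<-].
by rewrite -EFinD addrAC subrr add0r.
Qed.

Lemma pois_sum_small_opt :
  ((e - e ^+ 2 - delta * e)%:E <= pois_sum mu%:num (opt_bound ^~ 0%N))%E.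
Proof.
have m0 : 0 <= mu%:num by [].
have sumX : pois_sum mu%:num (fun k => delta * k%:R) = e%:E.
  rewrite (@pois_sumZ _ _ delta (fun k => k%:R))// [X in (_ * X)%E]pois_sum_id//.
  by rewrite -EFinM mean_amount.
have sumX2 : pois_sum mu%:num (fun k => delta ^+ 2 * k%:R ^+ 2) =
    (e ^+ 2 + delta * e)%:E.
  rewrite (@pois_sumZ _ _ _ (fun k => k%:R ^+ 2))//.
  by rewrite pois_sum_sqr// -EFinM /e -mean_amount; congr EFin; ring.
have : (e%:E <= pois_sum mu%:num (opt_bound ^~ 0%N) + (e ^+ 2 + delta * e)%:E)%E.
  have X2_0 (k : nat) : 0 <= delta ^+ 2 * k%:R ^+ 2 by rewrite mulr_ge0 ?sqr_ge0.
  rewrite -sumX -sumX2 -pois_sumD// => [|k]; last exact: opt_bound_ge0.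
  apply: le_pois_sum => // k; apply/andP; split; first by rewrite mulr_ge0// ltW.
  by rewrite -lerBlDr -exprMn /opt_bound /= le_max lexx orbT.
by rewrite -leeBlDr// -EFinB opprD addrA.
Qed.

(** A big arrival, of probability [1 - expR (- e)], is worth 1; in its absence,
    which is independent of the small arrivals, these are worth at least
    [X - X ^+ 2] with [X] of mean [e] and variance [delta * e]. *)
Lemma expected_opt_ge :
  (((e - e ^+ 2 - delta * e) * expR (- e) + (1 - expR (- e)))%:E <=
   expected_opt arrivals)%E.
Proof.
set q := expR (- e).
rewrite /expected_opt unlock.
have q0 : 0 <= q by exact: expR_ge0.
have q1 : 0 <= 1 - q by rewrite subr_ge0 -expR0 ler_expR oppr_le0 ltW.
pose h (w : spath * spath) : \bar R :=
  (opt_bound (part_size 0 w.1) (part_size 1 w.2))%:E.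
apply: (le_trans _ (ge0_le_integral_lower (hard_law mu eps) (f := h) _ _));
  last 2 first.
- by move=> w; rewrite lee_fin opt_bound_ge0.
- by move=> w; rewrite lee_fin; apply: opt_hard_ge; exact: type_part_type.
have mh : measurable_fun setT h.
  have mN0 : measurable_fun setT (fun w : spath * spath => part_size 0 w.1).
    apply: (measurableT_comp _ measurable_fst).
    by apply: measurable_nat_fun => k; exact: (measurable_part_size 0 [set k]).
  have mN1 : measurable_fun setT (fun w : spath * spath => part_size 1 w.2).
    apply: (measurableT_comp _ measurable_snd).
    by apply: measurable_nat_fun => k; exact: (measurable_part_size 1 [set k]).
  rewrite (_ : h = fun w => if (0 < part_size 1%R w.2)%N then 1%E
      else (opt_bound (part_size 0 w.1) 0)%:E); last first.
    by apply/funext => w; rewrite /h /opt_bound; case: ifP.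
  apply: measurable_fun_ifT => //.
    exact: (measurableT_comp (f := leq 1) _ mN1).
  exact: (measurableT_comp (f := fun k => (opt_bound k 0)%:E) _ mN0).
have h0 w : (0 <= h w)%E by rewrite lee_fin opt_bound_ge0.
rewrite [leRHS](fubini_tonelli1 (m1 := law 0) (m2 := law 1) h mh h0).
rewrite (_ : fubini_F _ _ =
    fun x => (opt_bound (part_size 0 x) 0 * q + (1 - q))%:E); last first.
  apply/funext => x; rewrite /fubini_F /h /=.
  by rewrite [LHS](integral_part_size 1 (opt_bound_ge0 _)) pois_sum_opt_bound.
rewrite [leRHS](integral_part_size 0
  (g := fun k => opt_bound k 0 * q + (1 - q))); last first.
  by move=> k; rewrite addr_ge0// mulr_ge0// opt_bound_ge0.
rewrite pois_sumD//; last by move=> k; rewrite mulr_ge0// opt_bound_ge0.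
rewrite (_ : (fun k => _ * q) = fun k => q * opt_bound k 0); last first.
  by apply/funext => k; rewrite mulrC.
rewrite pois_sumZ//; last by move=> k; exact: opt_bound_ge0.
rewrite pois_sum_cst// EFinD leeD2r// mulrC EFinM lee_wpmul2l ?lee_fin//.
exact: pois_sum_small_opt.
Qed.

End hard_expectations.

(** * The competitive ratio *)

Lemma competitive_ratio_le {R : realType} (ALG : online_algorithm R) (e : R) :
  0 < e -> e <= 8^-1 ->
  (competitive_ratio ALG <= ((1 + 2 * e) / (2 - 4 * e))%:E)%E.
Proof.
move=> e0 e8; pose delta := e ^+ 3.
have delta0 : 0 < delta by rewrite exprn_gt0.
have delta01 : 0 <= delta <= 1.
  rewrite ltW//= exprn_ile1//; first exact: ltW.
  by apply: le_trans e8 _; lra.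
have mu0 : 0 <= e ^- 2 by rewrite invr_ge0 sqr_ge0.
pose mu : {nonneg R} := NngNum mu0.
pose eps : {nonneg R} := NngNum (ltW e0).
have e_neq0 : e != 0 by rewrite gt_eqF.
have mean_amount : delta * mu%:num = eps%:num.
  by rewrite /delta /=; field.
have eps_gt0 : 0 < eps%:num by [].
have epsE : eps%:num = e by [].
have opt_ge := expected_opt_ge delta01 delta0 eps_gt0 mean_amount.
have alg_le := expected_alg_le delta0 eps_gt0 mean_amount
  (ALG (hard_instance mu eps delta01)).
rewrite epsE in opt_ge alg_le; clear epsE.
set q := expR (- e) in opt_ge.
have q_ge : 1 - e <= q by exact: expR_ge1Dx.
have q_le : q <= 1 - e + e ^+ 2.
  rewrite /q expRN; apply: (@le_trans _ _ (1 + e)^-1).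
    by rewrite lef_pV2 ?posrE ?expR_gt0 ?addr_gt0// expR_ge1Dx.
  rewrite -div1r ler_pdivrMr; last by lra.
  rewrite -subr_ge0 (_ : _ - 1 = e ^+ 3); last by ring.
  exact: ltW.
have a_le : e + e ^+ 2 + delta / (4 * e) <= e * (1 + 2 * e).
  rewrite (_ : delta / (4 * e) = e ^+ 2 / 4); last by rewrite /delta; field.
  rewrite expr2; nra.
have o_ge : e * (2 - 4 * e) <= (e - e ^+ 2 - delta * e) * q + (1 - q).
  have d_le : delta <= e ^+ 2 by rewrite /delta exprS ler_piMl ?sqr_ge0//; lra.
  have e2_le : e ^+ 2 <= e / 8 by rewrite expr2 ler_wpM2l// ltW.
  have de0 : delta * e <= e ^+ 2.
    by rewrite expr2 ler_wpM2r ?ltW//; lra.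
  have A0 : 0 <= e - e ^+ 2 - delta * e by lra.
  have : (e - e ^+ 2 - delta * e) * (1 - e) <= (e - e ^+ 2 - delta * e) * q.
    by rewrite ler_wpM2l.
  have e3 : 0 <= e ^+ 3 by exact: ltW.
  have de2 : 0 <= delta * e ^+ 2 by rewrite mulr_ge0 ?sqr_ge0// ltW.
  have -> : (e - e ^+ 2 - delta * e) * (1 - e) =
      e - e ^+ 2 * 2 - delta * e + e ^+ 3 + delta * e ^+ 2 by ring.
  have -> : e * (2 - 4 * e) = 2 * e - 4 * e ^+ 2 by ring.
  by lra.
have den_gt0 : 0 < 2 - 4 * e by lra.
set arr := hard_arrivals mu eps delta01 in opt_ge alg_le.
have o_gt0 : ((e * (2 - 4 * e))%:E <= expected_opt arr)%E.
  by apply: le_trans opt_ge; rewrite lee_fin.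
have eo_gt0 : (0 < expected_opt arr)%E.
  by apply: lt_le_trans o_gt0; rewrite lte_fin mulr_gt0.
apply: (@le_trans _ _ (expected_alg (ALG _) arr / expected_opt arr)%E).
  by apply: ereal_inf_lbound; exists (hard_instance mu eps delta01), arr.
have K_gt0 : 0 < (1 + 2 * e) / (2 - 4 * e) by rewrite divr_gt0//; lra.
(* If the expected optimum were infinite, the quotient would be 0. *)
case: (expected_opt arr) o_gt0 eo_gt0 => [r||]//= o_le r0.
  rewrite lte_fin in r0; rewrite inver gt_eqF// lee_pdivrMr//.
  apply: le_trans alg_le _; rewrite -EFinM lee_fin.
  apply: le_trans a_le _.
  apply: (@le_trans _ _ ((1 + 2 * e) / (2 - 4 * e) * (e * (2 - 4 * e)))).
    by rewrite le_eqVlt; apply/orP; left; apply/eqP; field; rewrite gt_eqF.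
  by rewrite ler_wpM2l// ltW.
by rewrite invey mule0 lee_fin ltW.
Qed.

Theorem proposition1 (R : realType) (ALG : online_algorithm R) :
  (competitive_ratio ALG <= (2^-1 : R)%:E)%E.
Proof.
apply/lee_addgt0Pr => eta eta_gt0; pose e : R := Num.min 8^-1 (eta / 4).
have e_gt0 : 0 < e by rewrite lt_min invr_gt0 ltr0n divr_gt0.
have e8 : e <= 8^-1 by rewrite ge_min lexx.
have e_eta : e <= eta / 4 by rewrite ge_min lexx orbT.
apply: le_trans (competitive_ratio_le ALG e_gt0 e8) _.
rewrite -EFinD lee_fin ler_pdivrMr; last by lra.
by nra.
Qed.
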